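(* Let $A$ be a finite alphabet with at least two symbols. The conjugacy relation on the standard Borel space of symbolic systems over $A$ with the specification property is not smooth.
   Context: Let $A$ be a finite discrete set (alphabet) and $\sigma\colon A^{\mathbb Z}\to A^{\mathbb Z}$, $\sigma(x)(n)=x(n+1)$, the shift. A symbolic system over $A$ is a nonempty closed set $X\subseteq A^{\mathbb Z}$ with $\sigma(X)=X$, considered with the restriction of $\sigma$. Symbolic systems over $A$ are viewed as elements of the space of nonempty closed subsets of $A^{\mathbb Z}$ with the Vietoris topology; those with the specification property form a Borel subset, hence a standard Borel space. Two systems $(X,\varphi)$, $(Y,\psi)$ (compact metric spaces with homeomorphisms) are conjugate if there is a homeomorphism $\rho\colon X\to Y$ with $\rho\varphi=\psi\rho$. Specification property: a system $(X,\tau)$ with metric $d$ on $X$ has the specification property if for every $\varepsilon>0$ there is $k\in\mathbb N$ such that for all $n\ge 2$, all $x_1,\dots,x_n\in X$ and all integers $0\le a_1<b_1$, $a_2<b_2,\dots,a_n<b_n$ with $a_i-b_{i-1}\ge k$ for $2\le i\le n$, there is $y\in X$ with $d(\tau^j(x_i),\tau^j(y))\le\varepsilon$ for all $1\le i\le n$ and $a_i\le j<b_i$. An equivalence relation $E$ on a standard Borel space $X$ is smooth if there are a standard Borel space $Y$ and a Borel map $f\colon X\to Y$ such that for all $x,y\in X$: $x\mathrel{E}y$ if and only if $f(x)=f(y)$. *)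

(* Defs.v *)
From HB Require Import structures.
From mathcomp Require Import all_boot all_order all_algebra.
From mathcomp Require Import all_classical all_reals all_analysis.
From mathcomp Require Import zify.

Set Implicit Arguments.
Unset Strict Implicit.
Unset Printing Implicit Defensive.

Import Order.TTheory GRing.Theory Num.Theory.
Import numFieldNormedType.Exports.

Local Open Scope classical_set_scope.
Local Open Scope ring_scope.

Record hyperspace (T : topologicalType) := Hyperspace {
  hyper_set :> set T ;
  hyper_closed : closed hyper_set ;
  hyper_nonempty : hyper_set !=set0 }.

Definition vietoris_subbase (T : topologicalType) : set (set (hyperspace T)) :=
  [set W | exists2 U : set T, open U &
     W = [set K : hyperspace T | K `<=` U] \/
     W = [set K : hyperspace T | (K `&` U) !=set0]].

HB.instance Definition _ (T : topologicalType) := gen_eqMixin (hyperspace T).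
HB.instance Definition _ (T : topologicalType) :=
  gen_choiceMixin (hyperspace T).
HB.instance Definition _ (T : topologicalType) :=
  isSubBaseTopological.Build (hyperspace T) (@vietoris_subbase T) id.

Definition borel_sets (T : topologicalType) : set (set T) := <<s @open T >>.

(* A Hausdorff pseudometric space is a metric space, so [M] ranges over the
   separable complete metric spaces. *)
Definition standard_borel (R : realType) d (Y : measurableType d) : Prop :=
  exists M : completePseudoMetricType R,
    [/\ hausdorff_space M,
        (exists2 D : set M, countable D & dense D) &
        exists2 g : Y -> M, bijective g &
          @measurable d Y = [set g @^-1` B | B in @borel_sets M]].

(* [T] carries its Borel sigma-algebra; it is not made a [measurableType]
   because the library requires these to be pointed. *)
Definition smooth (R : realType) (T : topologicalType) (E : T -> T -> Prop) :
    Prop :=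
  exists (d : measure_display) (Y : measurableType d) (f : T -> Y),
    [/\ standard_borel R Y,
        (forall B : set Y, measurable B -> borel_sets (f @^-1` B)) &
        forall x y, E x y <-> f x = f y].

(* Maps between the subspaces X and Y are represented by total functions, whose
   values outside X (resp. Y) are irrelevant. *)
Definition homeomorphism_between (T U : topologicalType) (X : set T)
    (Y : set U) (f : T -> U) : Prop :=
  [/\ {within X, continuous f}, set_fun X Y f &
      exists g : U -> T,
        [/\ {within Y, continuous g}, set_fun Y X g,
            {in X, cancel f g} & {in Y, cancel g f}]].

Definition conjugate (T U : topologicalType) (X : set T) (phi : T -> T)
    (Y : set U) (psi : U -> U) : Prop :=
  exists2 rho : T -> U, homeomorphism_between X Y rho &
    {in X, forall x, rho (phi x) = psi (rho x)}.

Definition specification (R : realType) (T : Type) (dist : T -> T -> R)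
    (X : set T) (tau : T -> T) : Prop :=
  forall eps : R, 0 < eps -> exists k : nat,
    forall (n : nat) (x : 'I_n -> T) (a b : 'I_n -> nat),
      (2 <= n)%N -> (forall i, X (x i)) -> (forall i, (a i < b i)%N) ->
      (forall i j : 'I_n, j = i.+1 :> nat -> (b i + k <= a j)%N) ->
      exists2 y, X y &
        forall (i : 'I_n) (j : nat), (a i <= j < b i)%N ->
          dist (iter j tau (x i)) (iter j tau y) <= eps.

Definition full_shift (A : finType) := {ptws int -> discrete_topology A}.

HB.instance Definition _ (A : finType) := Topological.on (full_shift A).

Definition shift (A : finType) (x : full_shift A) : full_shift A :=
  fun n => x (n + 1).

(* [sup set0 = 0], so this is 0 when x = y and 2^-m otherwise, where m is the
   least `|n| such that x n <> y n. *)
Definition shift_dist (R : realType) (A : finType) (x y : full_shift A) : R :=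
  sup [set r | exists2 n : int, x n <> y n & r = 2^-1 ^+ `|n|%N].

Section shift_dist_metric.
Variables (R : realType) (A : finType).
Local Notation dist := (@shift_dist R A).
Implicit Types x y z : full_shift A.

Let D x y : set R :=
  [set r | exists2 n : int, x n <> y n & r = 2^-1 ^+ `|n|%N].

Let dist_ge x y n : x n <> y n -> 2^-1 ^+ `|n|%N <= dist x y.
Proof.
move=> xy; apply: ub_le_sup; last by exists n.
by exists 1 => _ [m _ ->]; rewrite exprn_ile1// invf_le1// ler1n.
Qed.

Let dist_le x y e : 0 <= e ->
  (forall n, x n <> y n -> 2^-1 ^+ `|n|%N <= e) -> dist x y <= e.
Proof.
move=> e0 h; rewrite /shift_dist -/(D x y).
have [->|D0] := eqVneq (D x y) set0; first by rewrite sup0.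
by apply: ge_sup; [exact/set0P|move=> _ [n xy ->]; exact: h].
Qed.

Lemma shift_dist_xx x : dist x x = 0.
Proof.
rewrite /shift_dist (_ : [set r | _] = set0) ?sup0//.
by rewrite -subset0 => r [n].
Qed.

Lemma shift_dist_ge0 x y : 0 <= dist x y.
Proof.
have [|] := pselect (exists n, x n <> y n).
  by move=> [n /dist_ge]; apply: le_trans; rewrite exprn_ge0.
move=> /forallNP xy; suff -> : x = y by rewrite shift_dist_xx.
by apply/funext => n; exact: contrapT (xy n).
Qed.

Lemma shift_dist_eq0 x y : dist x y = 0 -> x = y.
Proof.
move=> xy0; apply/funext => n; apply: contrapT => /dist_ge.
by rewrite xy0 leNgt exprn_gt0.
Qed.

Lemma shift_dist_sym x y : dist x y = dist y x.
Proof.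
by apply/eqP; rewrite eq_le !dist_le ?shift_dist_ge0// => n xy;
  apply: dist_ge; exact: nesym.
Qed.

Lemma shift_dist_triangle y x z : dist x z <= dist x y + dist y z.
Proof.
apply: dist_le => [|n xz]; first by rewrite addr_ge0 ?shift_dist_ge0.
have [xy|xy] := pselect (x n = y n).
  by rewrite ler_wpDl ?shift_dist_ge0// dist_ge// -xy.
by rewrite ler_wpDr ?shift_dist_ge0// dist_ge.
Qed.

Let nbhs_coord x n : nbhs x [set y | y n = x n].
Proof.
have /(_ x) := @proj_continuous int (fun=> discrete_topology A) n.
by move=> /(_ [set x n]); apply; exact: discrete_set1.
Qed.

Lemma nbhs_shift_dist x :
  nbhs x = filter_from [set e : R | 0 < e] (fun e => [set y | dist x y < e]).
Proof.
set F := filter_from _ _.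
have FF : Filter F.
  apply: filter_from_filter; first by exists 1 => /=.
  move=> e f /= e0 f0; exists (Num.min e f); first by rewrite /= lt_min e0.
  by move=> y /=; rewrite lt_min => /andP[].
apply/seteqP; split.
- suff : F --> x by [].
  apply/cvg_sup => n U /=.
  have /= -> := @nbhsE (initial_topology
    (fun f : int -> discrete_topology A => f n)) x.
  move=> [_ [[V oV <-] /= Vx] VU].
  apply: filterS VU _; exists (2^-1 ^+ `|n|%N) => [|y /= xy].
    by rewrite /= exprn_gt0.
  rewrite /= (_ : y n = x n)//; apply: contrapT => /nesym/dist_ge.
  by rewrite leNgt xy.
- move=> U [e /= e0] /filterS; apply.
  have [N Ne] : exists N : nat, 2^-1 ^+ N < e :> R.
    have /cvgrPdist_lt /(_ _ e0) [N _ /(_ N (leqnn N))] :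
      (fun n => 2^-1 ^+ n : R) @ \oo --> 0.
      by apply: cvg_expr; rewrite ger0_norm ?invf_lt1 ?ltr1n.
    by rewrite sub0r normrN ger0_norm ?exprn_ge0// => ?; exists N.
  have near_x M : nbhs x [set y | forall n : int, (`|n| < M)%N -> y n = x n].
    elim: M => [|M IH]; first by apply: filterS filterT => y _ n.
    have H1 := nbhs_coord x (Posz M); have H2 := nbhs_coord x (- Posz M).
    near=> y => n; rewrite ltnS leq_eqVlt => /orP[/eqP nM|].
      have [->|->] : n = Posz M \/ n = - Posz M by lia.
      + by near: y.
      + by near: y.
    by move: n; near: y.
  apply: filterS (near_x N) => y /= xy.
  apply: le_lt_trans Ne; apply: dist_le => [|n nxy]; first by rewrite exprn_ge0.
  rewrite ler_wiXn2l// ?invf_le1// ?ler1n// leqNgt; apply/negP => nN.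
  by apply: nxy; rewrite xy.
Unshelve. all: by end_near. Qed.

End shift_dist_metric.

Definition symbolic_systems (A : finType) : set (hyperspace (full_shift A)) :=
  [set X | @shift A @` X = X].
Arguments symbolic_systems : clear implicits.

Definition spec_systems (R : realType) (A : finType) :
    set (hyperspace (full_shift A)) :=
  symbolic_systems A `&`
  [set X | specification (@shift_dist R A) X (@shift A)].
Arguments spec_systems : clear implicits.

(* [spec_systems R A], as a type, has the subspace topology of the Vietoris
   topology, so its Borel sets are the traces of the Borel sets of the
   hyperspace. *)
Definition conjugacy (R : realType) (A : finType) (X Y : spec_systems R A) :
    Prop :=
  conjugate (set_val X : hyperspace _) (@shift A)
            (set_val Y : hyperspace _) (@shift A).

(* Main.v *)
Require Import Defs.
From mathcomp Require Import all_boot all_order all_algebra.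
From mathcomp Require Import all_classical all_reals all_analysis.
From mathcomp Require Import zify.

Set Implicit Arguments.
Unset Strict Implicit.
Unset Printing Implicit Defensive.

Import Order.TTheory GRing.Theory Num.Theory.
Import numFieldNormedType.Exports.

Local Open Scope classical_set_scope.
Local Open Scope ring_scope.

(** The equivalence relation E_0 of eventual agreement of binary sequences maps
into conjugacy, and a category argument turns this into non-smoothness.

Fix two distinct letters of the alphabet. To each [n] and each bit [b] is
attached a word [word n b] over these letters, of a length depending on [n]
only, such that no two occurrences of such words ever overlap
([occ_unique]): the pattern 00 occurs in them only at the start, and 111 only at
the end. A binary sequence [x] defines the subshift [avoid x] of the points that
contain none of the words [word n (x n)]. Then:

- [avoid x] has the specification property, because two of its points can
  always be glued across the block 000111 ([avoid_glue]);
- if [x] and [y] differ only at [n], exchanging all occurrences of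
  [word n false] and [word n true] is a conjugacy between [avoid x] and
  [avoid y] ([conjugate_avoid]); it is well defined and an involution, and it
  leaves the occurrences of the other words alone, because occurrences do not
  overlap;
- [x] is determined by [avoid x] ([avoid_inj]), and [avoid x] depends
  continuously on [x] ([prefix_open_avoid_system]);
- conjugacies are given by finite block codes (the Curtis-Hedlund-Lyndon
  theorem, [conjugate_block_map]), so that only countably many [y] give a system
  conjugate to [avoid x].

If conjugacy were smooth, countably many Borel sets of systems, each invariant
under conjugacy, would separate the conjugacy classes. Their preimages
under [x |-> avoid x] have the Baire property and are invariant under finite
changes of [x], hence are meager or comeager ([zero_one_law]). So all [x]
outside some meager set give conjugate systems. As these [x] are countably many,
the space of binary sequences would be meager, against [baire_category]. *)

(** * Non-overlapping words *)

(** The length of [word n b]. *)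
Definition wlen (n : nat) : nat := n.*2 + 10.

(** The word [word n b] is 00 (10)^n 1 b (~b) 1 0 111, given by its letter at
position [k]; its value is [true] at the positions [k >= wlen n]. *)
Definition word (n : nat) (b : bool) (k : nat) : bool :=
  if (k < 2)%N then false
  else if (k < n.*2 + 2)%N then ~~ odd k
  else if k == (n.*2 + 3)%N then b
  else if k == (n.*2 + 4)%N then ~~ b
  else k != (n.*2 + 6)%N.

Lemma word_no00 n b k : (0 < k)%N -> word n b k || word n b k.+1.
Proof. by rewrite /word; case: b; do ![case: ifP]; lia. Qed.

Lemma word_no111 n b k : (k + 3 < wlen n)%N ->
  ~~ [&& word n b k, word n b k.+1 & word n b k.+2].
Proof. by rewrite /word /wlen; case: b; do ![case: ifP]; lia. Qed.

Lemma word_end n b k : (wlen n <= k + 3)%N -> word n b k.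
Proof. by rewrite /word /wlen; do ![case: ifP]; lia. Qed.

Lemma word_diff n b : word n b (n.*2 + 3) = b.
Proof. by rewrite /word; do ![case: ifP]; lia. Qed.

Section Avoid.
Variables (A : finType) (alpha : bool -> A).
Hypothesis alpha_inj : injective alpha.
Implicit Types (z : full_shift A) (x y : nat -> bool) (p q t : int).

(** The word [word n b], spelled with the letters [alpha false] and
[alpha true], occurs in [z] at position [p]. Below, 0 and 1 also stand for these
two letters. *)
Definition occ z n b p :=
  forall k, (k < wlen n)%N -> z (p + k%:Z) = alpha (word n b k).

Lemma occ_at z n b p t : occ z n b p -> p <= t -> t < p + (wlen n)%:Z ->
  z t = alpha (word n b `|t - p|%N).
Proof.
move=> o pt tp; rewrite -o; last by lia.
by congr z; lia.
Qed.

Lemma occ_val z n b p k t e : occ z n b p -> t = p + k%:Z ->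
  (k < wlen n)%N -> z t = alpha e -> word n b k = e.
Proof. by move=> o -> kL; rewrite o// => /alpha_inj. Qed.

Lemma wlen_ge n : (10 <= wlen n)%N. Proof. by rewrite /wlen; lia. Qed.

(** Two occurrences, the second of which starts within the first, coincide. *)
Lemma occ_disjoint z n m b c p q : occ z n b p -> occ z m c q ->
  p <= q -> q < p + (wlen n)%:Z -> [/\ p = q, n = m & b = c].
Proof.
move=> on om pq qp.
have Ln := wlen_ge n; have Lm := wlen_ge m.
have E : p = q.
  apply/eqP; rewrite eq_le pq /= leNgt; apply/negP => pq'.
  (* The 00 starting the second word would lie inside the first one; since the
     first one ends in 111, it would contain both of these letters. *)
  have h0 : z q = alpha false by rewrite -(addr0 q) (om 0%N)//; lia.
  have h1 : z (q + 1) = alpha false by rewrite (om 1%N)//; lia.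
  have w0 : word n b `|q - p|%N = false by apply: (occ_val on _ _ h0); lia.
  have ql : (`|q - p|%N + 3 < wlen n)%N.
    by rewrite ltnNge; apply/negP => /(word_end b); rewrite w0.
  have w1 : word n b `|q - p|%N.+1 = false by apply: (occ_val on _ _ h1); lia.
  have := @word_no00 n b `|q - p|%N; rewrite w0 w1 /=; lia.
(* Of two words starting at the same place, the end 111 of the shorter one
   would lie inside the longer one. *)
have shorter z' n' m' b' c' r : occ z' n' b' r -> occ z' m' c' r ->
    (wlen m' <= wlen n')%N.
  move=> on' om'; rewrite leqNgt; apply/negP => nm.
  have Ln' := wlen_ge n'.
  have e3 k : (wlen n' <= k + 3)%N -> (k < wlen n')%N -> word m' c' k.
    move=> k3 kL; apply: (occ_val om' (erefl _)); first by lia.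
    by rewrite on'// word_end.
  have := @word_no111 m' c' (wlen n' - 3)%N; rewrite !e3/=; lia.
subst q.
have nm : n = m.
  have := shorter _ _ _ _ _ _ on om; have := shorter _ _ _ _ _ _ om on.
  by rewrite /wlen; lia.
subst m; split => //.
rewrite -(word_diff n b); apply: (occ_val on (erefl _)).
  by rewrite /wlen; lia.
by rewrite om ?word_diff// /wlen; lia.
Qed.

Lemma occ_unique z n m b c p q t : occ z n b p -> occ z m c q ->
  p <= t < p + (wlen n)%:Z -> q <= t < q + (wlen m)%:Z ->
  [/\ p = q, n = m & b = c].
Proof.
move=> on om pt qt; have [pq|qp] := leP p q.
  by apply: occ_disjoint on om pq _; lia.
by have [] := occ_disjoint om on (ltW qp); first lia.
Qed.

(** The subshift of the points containing none of the words [word n (x n)]. *)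
Definition avoid x : set (full_shift A) :=
  [set z | forall n p, ~ occ z n (x n) p].

(** The point equal to [z] on the interval from [l] to [r - 1], to 1 on its left
and to 0 on its right. *)
Definition pad l r z : full_shift A := fun t =>
  if t < l then alpha true else if t < r then z t else alpha false.

(** Padding creates no occurrence: words start with 0 and end with 1. *)
Lemma occ_pad l r z n b p : occ (pad l r z) n b p ->
  [/\ l <= p, p + (wlen n)%:Z <= r & occ z n b p].
Proof.
move=> o; have Ln := wlen_ge n.
have lp : l <= p.
  rewrite leNgt; apply/negP => pl.
  have := o 0%N; rewrite addr0 /pad pl => /(_ _)/alpha_inj.
  by rewrite /word /=; lia.
have pr : p + (wlen n)%:Z <= r.
  rewrite leNgt; apply/negP => rp.
  have := o (wlen n).-1; rewrite /pad.
  rewrite word_end; last by lia.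
  have -> : (p + (wlen n).-1 < l) = false by lia.
  have -> : (p + (wlen n).-1 < r) = false by lia.
  by move=> h; have /alpha_inj : alpha false = alpha true by apply: h; lia.
split=> // k kL; rewrite -o// /pad.
have -> : (p + k < l) = false by lia.
by have -> : (p + k < r) = true by lia.
Qed.

(** The point equal to [z] before [c], and to [z'] from [c + 6] on, with the
block 000111 in between. *)
Definition glue (c : int) z z' : full_shift A := fun t =>
  if t < c then z t else if t < c + 3 then alpha false
  else if t < c + 6 then alpha true else z' t.

Lemma glue_left c z z' t : t < c -> glue c z z' t = z t.
Proof. by rewrite /glue => ->. Qed.

Lemma glue_right c z z' t : c + 6 <= t -> glue c z z' t = z' t.
Proof. by move=> ct; rewrite /glue; do ![case: ifP] => //; lia. Qed.

(** Gluing creates no occurrence: a word starts with 00, ends with 1, and does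
not contain 000 or 00111. *)
Lemma occ_glue c z z' n b p :
  occ (glue c z z') n b p -> occ z n b p \/ occ z' n b p.
Proof.
move=> o; have Ln := wlen_ge n.
have g0 t : c <= t < c + 3 -> glue c z z' t = alpha false.
  by move=> ct; rewrite /glue; do ![case: ifP] => //; lia.
have g1 t : c + 3 <= t < c + 6 -> glue c z z' t = alpha true.
  by move=> ct; rewrite /glue; do ![case: ifP] => //; lia.
have v0 k : (k < wlen n)%N -> c <= p + k%:Z < c + 3 -> word n b k = false.
  by move=> kL /g0; exact: occ_val o _ _.
have v1 k : (k < wlen n)%N -> c + 3 <= p + k%:Z < c + 6 -> word n b k.
  by move=> kL /g1; exact: occ_val o _ _.
have [pc|pc] := ltP (p + (wlen n)%:Z) (c + 1).
  by left=> k kL; rewrite -o// glue_left//; lia.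
have [cp|cp] := leP (c + 6) p.
  by right=> k kL; rewrite -o// glue_right//; lia.
exfalso.
have [ec|ec] := ltP (p + (wlen n)%:Z) (c + 4).
  have := @word_end n b (wlen n).-1; rewrite v0; lia.
have [cp3|cp3] := leP (c + 3) p.
  have : word n b 0 by apply: v1; lia.
  by [].
have [pc0|pc0] := leP p c.
  have := @word_no00 n b `|c - p|%N.+1; rewrite !v0; lia.
have [pc1|pc1] := eqVneq p (c + 1).
  have := @word_no111 n b 2; rewrite !v1; lia.
have : word n b 1 by apply: v1; lia.
by [].
Qed.

Lemma avoid_glue x c z z' : avoid x z -> avoid x z' -> avoid x (glue c z z').
Proof. by move=> xz xz' n p /occ_glue[/xz|/xz']. Qed.

(** A padded copy of one word contains no other one. *)
Lemma occ_display n b m c p :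
  occ (pad 0 (wlen n)%:Z (fun t => alpha (word n b `|t|%N))) m c p ->
  n = m /\ b = c.
Proof.
move=> o; have [p0 pL _] := occ_pad o.
have on : occ (pad 0 (wlen n)%:Z (fun t => alpha (word n b `|t|%N))) n b 0.
  move=> k kL; rewrite /pad.
  have -> : (0 + k%:Z < 0) = false by lia.
  have -> : (0 + k%:Z < (wlen n)%:Z) = true by lia.
  by congr (alpha (word n b _)); lia.
have Lm := wlen_ge m.
by have [] := occ_disjoint on o p0; first lia.
Qed.

Lemma avoid_inj x y : avoid x `<=` avoid y -> x = y.
Proof.
move=> xy; apply/funext => n; apply: contrapT => xyn.
set z : full_shift A :=
  pad 0 (wlen n)%:Z (fun t => alpha (word n (y n) `|t|%N)).
have /xy /(_ n 0) : avoid x z.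
  by move=> m p /occ_display[nm yx]; subst m; apply: xyn.
apply => k kL; rewrite /z /pad.
have -> : (0 + k%:Z < 0) = false by lia.
have -> : (0 + k%:Z < (wlen n)%:Z) = true by lia.
by congr (alpha (word n _ _)); lia.
Qed.

Lemma occ_shift z n b p : occ (Defs.shift z) n b p <-> occ z n b (p + 1).
Proof.
by split=> o k /o <-; rewrite /Defs.shift; congr z; lia.
Qed.

End Avoid.

(** * Baire category in the space of binary sequences *)

Local Notation cantor := (nat -> bool).

(** The binary sequences [x] and [y] have the same first [n] terms. The classes
of [agree n], for all [n], are the basic open sets of the product topology. *)
Definition agree (n : nat) (x y : cantor) : Prop :=
  forall k, (k < n)%N -> x k = y k.

Lemma agree_refl n x : agree n x x. Proof. by []. Qed.

Lemma agree_trans n x y z : agree n x y -> agree n y z -> agree n x z.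
Proof. by move=> xy yz k kn; rewrite xy// yz. Qed.

Lemma agreeW m n x y : (m <= n)%N -> agree n x y -> agree m x y.
Proof. by move=> mn xy k km; apply: xy; exact: leq_trans mn. Qed.

(** Openness in the product topology of [nat -> bool]. *)
Definition prefix_open (U : set cantor) : Prop :=
  forall x, U x -> exists n, forall y, agree n x y -> U y.

(** Nowhere density in the product topology: every basic open set contains one
that misses [S]. *)
Definition nowhere_dense (S : set cantor) : Prop :=
  forall x n, exists y m,
    [/\ agree n x y, (n <= m)%N & forall z, agree m y z -> ~ S z].

(** Containment in a countable union of nowhere dense sets. *)
Definition meager (S : set cantor) : Prop :=
  exists2 F : nat -> set cantor,
    (forall i, nowhere_dense (F i)) & S `<=` \bigcup_i F i.

(** Equality with an open set up to a meager set. *)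
Definition baire_property (S : set cantor) : Prop :=
  exists2 U, prefix_open U & meager ((S `\` U) `|` (U `\` S)).

Lemma sub_meager S T : S `<=` T -> meager T -> meager S.
Proof. by move=> ST [F nF TF]; exists F => //; exact: subset_trans TF. Qed.

Lemma nowhere_dense0 : nowhere_dense set0.
Proof. by move=> x n; exists x, n; split => // z _ []. Qed.

Lemma nowhere_dense1 x : nowhere_dense [set x].
Proof.
move=> y n; exists (fun k => if (k < n)%N then y k else ~~ x k), n.+1.
split=> // [k ->//|z yz zx]; have := yz n (ltnSn n).
by rewrite zx ltnn; case: (x n).
Qed.

Lemma nowhere_dense_meager S : nowhere_dense S -> meager S.
Proof. by move=> nS; exists (fun=> S) => // x Sx; exists 0%N. Qed.

Lemma meager_bigcup (I : countType) (S : I -> set cantor) :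
  (forall i, meager (S i)) -> meager (\bigcup_i S i).
Proof.
move=> mS; have /choice[F FP] : forall i, exists F : nat -> set cantor,
    (forall j, nowhere_dense (F j)) /\ S i `<=` \bigcup_j F j.
  by move=> i; have [F] := mS i; exists F.
exists (fun j => if unpickle j is Some u then F (u : I * nat).1 u.2 else set0).
  move=> j; case: unpickle => [u|]; first exact: (FP u.1).1.
  exact: nowhere_dense0.
move=> x [i _ /(FP i).2 [j _ Fx]].
by exists (pickle (i, j)) => //; rewrite pickleK.
Qed.

Lemma meagerU S T : meager S -> meager T -> meager (S `|` T).
Proof.
move=> mS mT; apply: (@sub_meager _ (\bigcup_b (if b then S else T))).
  by move=> x [Sx|Tx]; [exists true|exists false].
by apply: meager_bigcup; case.
Qed.

(** The Baire category theorem for [nat -> bool]. *)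
Lemma baire_category : ~ meager setT.
Proof.
move=> [F nF FT].
(* [h i] shrinks a basic open set, coded by a point and a length, to one that
   misses [F i]; iterating it gives nested basic open sets, whose lengths are
   made to increase strictly, and which meet in the point [x]. *)
have step (i : nat) : exists h : cantor * nat -> cantor * nat, forall u,
    [/\ agree u.2 u.1 (h u).1, (u.2 <= (h u).2)%N &
        forall z, agree (h u).2 (h u).1 z -> ~ F i z].
  have /choice : forall u : cantor * nat, exists v : cantor * nat,
      [/\ agree u.2 u.1 v.1, (u.2 <= v.2)%N &
          forall z, agree v.2 v.1 z -> ~ F i z].
    by move=> u; have [y [m H]] := nF i u.1 u.2; exists (y, m).
  by case=> h H; exists h.
have {step} /choice[h hP] := step.
pose fix s i : cantor * nat :=
  if i is j.+1 then let u := h j (s j) in (u.1, u.2.+1)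
  else (fun=> false, 0%N).
have s_le i j : (i <= j)%N ->
    ((s i).2 <= (s j).2)%N /\ agree (s i).2 (s i).1 (s j).1.
  elim: j => [|j IH]; first by rewrite leqn0 => /eqP ->.
  rewrite leq_eqVlt => /orP[/eqP -> //|]; rewrite ltnS => /IH[ij aij].
  have [aj jj _] := hP j (s j); split => /=.
    exact: leq_trans ij (leqW jj).
  by apply: agree_trans aij _; exact: agreeW aj.
have s_ge i : (i <= (s i).2)%N.
  by elim: i => //= i IH; have [_ jj _] := hP i (s i); lia.
pose x : cantor := fun k => (s k.+1).1 k.
have xP i : agree (s i).2 (s i).1 x.
  move=> k ki; rewrite /x.
  have [/s_le[_]|/ltnW/s_le[_]] := leqP i k.+1; first by apply.
  by move=> -> //; exact: s_ge.
have [i _] := FT x I.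
have [_ _] := hP i (s i); apply.
by apply: (agreeW (leqnSn _)); exact: (xP i.+1).
Qed.

Lemma baire_property_open U : prefix_open U -> baire_property U.
Proof.
move=> oU; exists U => //.
by rewrite setDv setU0; exact: nowhere_dense_meager nowhere_dense0.
Qed.

Lemma baire_propertyC S : baire_property S -> baire_property (~` S).
Proof.
move=> [U oU mU].
(* [V] is the exterior of [U]; the boundary of [U] is nowhere dense. *)
pose V : set cantor := [set x | exists n, forall y, agree n x y -> ~ U y].
exists V.
  move=> x [n nU]; exists n => y xy; exists n => z yz; apply: nU.
  exact: agree_trans yz.
apply: (@sub_meager _ (((S `\` U) `|` (U `\` S)) `|` (~` U `\` V))).
  move=> x [[nS nV]|[[n nU] SS]].
    have [Ux|nU] := pselect (U x); first by left; right.
    by right.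
  left; left; split; [exact: contrapT|]. by apply: nU; exact: agree_refl.
apply: meagerU mU _; apply: nowhere_dense_meager => x n.
have [[y xy Uy]|nU] := pselect (exists2 y, agree n x y & U y).
  have [m mU] := oU y Uy; exists y, (maxn n m).
  split => //; first exact: leq_maxl.
  by move=> z /(agreeW (leq_maxr n m))/mU Uz [].
exists x, n; split => // y xy [_]; apply; exists n => z yz Uz; apply: nU.
by exists z => //; exact: agree_trans yz.
Qed.

Lemma baire_property_bigcup (S : nat -> set cantor) :
  (forall i, baire_property (S i)) -> baire_property (\bigcup_i S i).
Proof.
move=> bS; have /choice[U UP] : forall i, exists U, prefix_open U /\
    meager ((S i `\` U) `|` (U `\` S i)).
  by move=> i; have [U] := bS i; exists U.
exists (\bigcup_i U i).
  move=> x [i _ /(UP i).1[n nU]]; exists n => y /nU Uy; by exists i.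
apply: sub_meager (meager_bigcup (fun i => (UP i).2)) => x [[[i _ Sx] nU]|].
  by exists i => //; left; split=> // Ux; apply: nU; exists i.
move=> [[i _ Ux] nS]; exists i => //; right; split=> // Sx.
by apply: nS; exists i.
Qed.

Lemma finite_change_invariant (S : set cantor) :
    (forall n x y, (forall k, k <> n -> x k = y k) -> S x -> S y) ->
  forall n x y, (forall k, (n <= k)%N -> x k = y k) -> S x -> S y.
Proof.
move=> inv n; elim: n => [|n IH] x y xy Sx.
  by rewrite (_ : y = x)//; apply/funext => k; rewrite xy.
apply: (IH (fun k => if k == n then y n else x k)) => [k nk|].
  by have [->//|/eqP kn] := eqVneq k n; apply: xy; lia.
by apply: (inv n x _ _ Sx) => k /eqP/negPf ->.
Qed.

(** The topological zero-one law. *)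
Lemma zero_one_law (S : set cantor) : baire_property S ->
    (forall n x y, (forall k, k <> n -> x k = y k) -> S x -> S y) ->
  meager S \/ meager (~` S).
Proof.
move=> [U oU mU] inv.
have [[x Ux]|U0] := pselect (exists x, U x); last first.
  left; apply: sub_meager mU => x Sx; left; split => // Ux.
  by apply: U0; exists x.
right; have [n nU] := oU x Ux.
(* [S] is comeager in the basic open set of [x] and [n]; the finite change [e]
   brings every sequence into this set. *)
pose e (y : cantor) : cantor := fun k => if (k < n)%N then x k else y k.
have [F nF FS] := mU.
exists (fun i => e @^-1` F i).
  move=> i y m; have [z [l [yz ml zF]]] := nF i (e y) (maxn n m).
  exists (fun k => if (k < n)%N then y k else z k), l; split => //.
  - move=> k km; case: ltnP => // nk; rewrite -yz; last by lia.
    by rewrite /e ltnNge nk.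
  - by rewrite (leq_trans _ ml)// leq_maxr.
  - move=> w yw; apply: zF => k kl; rewrite /e; case: ltnP => nk.
      by rewrite -yz ?leq_max ?nk// /e nk.
    by rewrite -yw// ltnNge nk.
move=> y nS; apply: FS; right; split; first by apply: nU => k kn; rewrite /e kn.
apply: contra_not nS; apply: (finite_change_invariant inv (n := n)) => k nk.
by rewrite /e ltnNge nk.
Qed.

(** * Cylinders of the full shift *)

(** The bi-infinite sequences [z] and [z'] agree on the coordinates from [-N] to
[N]. *)
Definition near_agree (B : Type) (N : nat) (z z' : int -> B) : Prop :=
  forall t : int, (`|t| <= N)%N -> z' t = z t.

Section ShiftTopology.
Variables (R : realType) (A : finType).
Implicit Types (z : full_shift A) (N : nat).

Lemma shift_dist_le N z z' : near_agree N z z' ->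
  shift_dist R z z' <= 2^-1 ^+ N.
Proof.
move=> zz'; rewrite /shift_dist; set D : set R := [set r | _].
have [->|D0] := eqVneq D set0; first by rewrite sup0 exprn_ge0.
apply: ge_sup; [exact/set0P|move=> _ [n xy ->]].
rewrite ler_wiXn2l// ?invf_le1// ?ler1n// leqNgt; apply/negP => nN.
by apply: xy; rewrite zz'// ltnW.
Qed.

Lemma shift_dist_near N z z' :
  shift_dist R z z' < 2^-1 ^+ N -> near_agree N z z'.
Proof.
move=> zz' t tN; apply: contrapT => zt; move: zz'; apply/negP; rewrite -leNgt.
apply: (@le_trans _ _ (2^-1 ^+ `|t|%N)).
  by rewrite ler_wiXn2l// ?invf_le1// ?ler1n.
apply: ub_le_sup; last by exists t => // /esym.
by exists 1 => _ [m _ ->]; rewrite exprn_ile1// invf_le1// ler1n.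
Qed.

Lemma half_expn_small (e : R) : 0 < e -> exists N : nat, 2^-1 ^+ N < e.
Proof.
move=> e0; have /cvgrPdist_lt /(_ _ e0) [N _ /(_ N (leqnn N))] :
    (fun n => 2^-1 ^+ n : R) @ \oo --> 0.
  by apply: cvg_expr; rewrite ger0_norm ?invf_lt1 ?ltr1n.
by rewrite sub0r normrN ger0_norm ?exprn_ge0// => ?; exists N.
Qed.

Lemma nbhs_near_agree N z : nbhs z (near_agree N z).
Proof.
rewrite (nbhs_shift_dist R); exists (2^-1 ^+ N); first by rewrite /= exprn_gt0.
by move=> z' /shift_dist_near.
Qed.

Lemma nbhs_near_agreeP z (U : set (full_shift A)) : nbhs z U ->
  exists N, near_agree N z `<=` U.
Proof.
rewrite (nbhs_shift_dist R) => -[e /half_expn_small[N Ne] eU].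
exists N => z' /shift_dist_le zz'; apply: eU; exact: le_lt_trans Ne.
Qed.

Lemma compact_full_shift (K : set (full_shift A)) : closed K -> compact K.
Proof.
have cT : compact [set: full_shift A].
  have := @tychonoff int (fun=> discrete_topology A) (fun=> setT) (fun=> _).
  rewrite (_ : [set f | _] = setT); last by apply/seteqP; split.
  apply => i; apply: finite_compact; exact: (@finite_finset A).
by move=> cK; exact: subclosed_compact cK cT _.
Qed.

Lemma iter_shift j z t : iter j (@Defs.shift A) z t = z (t + j%:Z).
Proof.
elim: j t => [|j IH] t; first by rewrite addr0.
by rewrite iterS /Defs.shift IH; congr z; lia.
Qed.

End ShiftTopology.

(** * Specification of the subshifts avoiding words *)

Section AvoidSystem.
Variables (R : realType) (A : finType) (alpha : bool -> A).
Hypothesis alpha_inj : injective alpha.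
Implicit Types (z : full_shift A) (x y : nat -> bool).

Lemma closed_avoid x : closed (avoid alpha x).
Proof.
rewrite -openC openE => z /existsNP[n /existsNP[p /contrapT o]].
apply: filterS (nbhs_near_agree R (`|p|%N + wlen n) z) => z' zz' /(_ n p).
apply.
by move=> k kL; rewrite zz' ?o//; lia.
Qed.

Lemma avoid_const x : avoid alpha x (fun=> alpha true).
Proof.
move=> n p /(_ 0%N) h; have /alpha_inj// : alpha true = alpha false.
by apply: h; rewrite /wlen; lia.
Qed.

Lemma shift_avoid x : @Defs.shift A @` avoid alpha x = avoid alpha x.
Proof.
apply/seteqP; split=> [_ [z zx <-] n p /occ_shift/zx//|z zx].
exists (fun t => z (t - 1)); last first.
  by apply/funext => t; rewrite /Defs.shift addrK.
move=> n p o; apply: (zx n (p - 1)) => k /o <-; congr z; lia.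
Qed.

Lemma avoid_specification x :
  specification (@shift_dist R A) (avoid alpha x) (@Defs.shift A).
Proof.
move=> e /half_expn_small[N /ltW Ne].
(* The gap leaves room for widening by [N] on both sides and for 000111. *)
exists (N.*2 + 6)%N => n z a b n2 zx ab gap.
have b_le (i j : 'I_n) : (i <= j)%N -> (b i <= b j)%N.
  case: j => j; elim: j => [|j IH] jn /= ij.
    by rewrite (_ : i = Ordinal jn)//; apply: val_inj => /=; lia.
  move: ij; rewrite leq_eqVlt => /orP[/eqP ij|ij].
    by rewrite (_ : i = Ordinal jn)//; exact: val_inj.
  have := IH (ltnW jn) ij; have := gap (Ordinal (ltnW jn)) (Ordinal jn) erefl.
  by have := ab (Ordinal jn); lia.
(* Gluing the points one after the other, [y] can follow [z i] on the interval
   from [a i] to [b i] widened by [N] on both sides. *)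
have glued m : (m <= n)%N -> exists2 y, avoid alpha x y &
    forall i : 'I_n, (i < m)%N ->
    forall t : int, (a i)%:Z - N%:Z <= t < (b i)%:Z + N%:Z -> y t = z i t.
  elim: m => [|m IH] mn.
    by exists (fun=> alpha true) => //; exact: avoid_const.
  have [y yx yz] := IH (ltnW mn).
  pose om := Ordinal mn.
  have [m0|m_gt0] := posnP m.
    exists (z om) => // i im t _; rewrite (_ : i = om)//.
    by apply: val_inj => /=; lia.
  have m1n : (m.-1 < n)%N by lia.
  pose c : int := (b (Ordinal m1n))%:Z + N%:Z.
  exists (glue alpha c y (z om)); first exact: avoid_glue.
  move=> i; rewrite ltnS leq_eqVlt => /orP[/eqP im|im] t /andP[ta tb].
    rewrite (_ : i = om) ?glue_right//; last exact: val_inj.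
    have := gap (Ordinal m1n) om (esym (prednK m_gt0)).
    by move: ta; rewrite /c (_ : i = om); [lia|exact: val_inj].
  rewrite glue_left; first by apply: yz => //; rewrite ta.
  have /b_le : (i <= Ordinal m1n)%N by rewrite /=; lia.
  rewrite /c; lia.
have [y yx yz] := glued n (leqnn n).
exists y => // i j /andP[aj jb]; apply: le_trans Ne.
apply: shift_dist_le => t tN.
by rewrite !iter_shift; apply: yz => //; lia.
Qed.

(** The subshift [avoid alpha x] as a point of the hyperspace. *)
Definition avoid_space x : hyperspace (full_shift A) :=
  Hyperspace (closed_avoid (x := x)) (ex_intro _ _ (@avoid_const x)).

Lemma avoid_spec_systems x : avoid_space x \in spec_systems R A.
Proof.
by apply/mem_set; split; [exact: shift_avoid|exact: avoid_specification].
Qed.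

(** The subshift [avoid alpha x] as a system with the specification property. *)
Definition avoid_system x : spec_systems R A :=
  exist (fun X => X \in spec_systems R A) _ (avoid_spec_systems x).

End AvoidSystem.

(** * Exchanging the two words of an index *)

Section Swap.
Variables (R : realType) (A : finType) (alpha : bool -> A).
Hypothesis alpha_inj : injective alpha.
Implicit Types (z : full_shift A) (x y : nat -> bool) (p t : int).
Local Notation occ := (occ alpha).

(** The point obtained from [z] by replacing each occurrence of [word n b] by
[word n (~~ b)]. The occurrence covering a coordinate [t], chosen here by
[cid], is unique. *)
Definition swap (n : nat) z : full_shift A := fun t =>
  if pselect (exists u : bool * int, occ z n u.1 u.2 /\
     u.2 <= t < u.2 + (wlen n)%:Z) is left h
  then let u := projT1 (cid h) in alpha (word n (~~ u.1) `|t - u.2|%N)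
  else z t.

Lemma swap_in n z b p t : occ z n b p -> p <= t < p + (wlen n)%:Z ->
  swap n z t = alpha (word n (~~ b) `|t - p|%N).
Proof.
move=> o pt; rewrite /swap; case: pselect => [h|]; last by case; exists (b, p).
case: cid => -[c q] /= [zo qt].
by have [-> _ ->] := occ_unique alpha_inj o zo pt qt.
Qed.

Lemma swap_out n z t :
  (forall b p, occ z n b p -> ~~ (p <= t < p + (wlen n)%:Z)) ->
  swap n z t = z t.
Proof.
move=> h; rewrite /swap; case: pselect => // -[[b p] /= [zo pt]].
by case/negP: (h _ _ zo).
Qed.

Lemma occ_swap_same n z b p : occ z n b p -> occ (swap n z) n (~~ b) p.
Proof.
move=> o k kL; rewrite (swap_in o); last by lia.
by congr (alpha (word n _ _)); lia.
Qed.

(** Exchanging the words of index [n] affects no other occurrence. *)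
Lemma occ_swapP n z m c p :
  occ (swap n z) m c p <-> occ z m (if m == n then ~~ c else c) p.
Proof.
have Lm := wlen_ge m.
split=> [zo|].
- have [[[b q] /= [oq [k kL qk]]]|nq] := pselect (exists u : bool * int,
      occ z n u.1 u.2 /\ exists2 k, (k < wlen m)%N &
      u.2 <= p + k%:Z < u.2 + (wlen n)%:Z).
    have pk : p <= p + k%:Z < p + (wlen m)%:Z by lia.
    have [<- <- <-] := occ_unique alpha_inj (occ_swap_same oq) zo qk pk.
    by rewrite eqxx negbK.
  have oz : occ z m c p.
    move=> k kL; rewrite -zo// swap_out// => b q oq; apply/negP => qk.
    by apply: nq; exists (b, q); split => //; exists k.
  case: eqVneq => // mn; subst m; exfalso; apply: nq.
  by exists (c, p); split => //; exists 0%N => /=; lia.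
- case: eqVneq => [-> /occ_swap_same|mn o k kL]; first by rewrite negbK.
  rewrite swap_out ?o// => b q oq; apply/negP => qk.
  have pk : p <= p + k%:Z < p + (wlen m)%:Z by lia.
  have [_ nm _] := occ_unique alpha_inj oq o qk pk.
  by rewrite nm eqxx in mn.
Qed.

Lemma swapK n : involutive (swap n).
Proof.
move=> z; apply/funext => t.
have [[[b p] /= [zo pt]]|h] := pselect (exists u : bool * int,
    occ z n u.1 u.2 /\ u.2 <= t < u.2 + (wlen n)%:Z).
  by rewrite (swap_in (occ_swap_same zo) pt) negbK (occ_at zo)//; lia.
have hz b p : occ z n b p -> ~~ (p <= t < p + (wlen n)%:Z).
  by move=> o; apply/negP => pt; apply: h; exists (b, p).
rewrite swap_out => [|b p /occ_swapP]; last by rewrite eqxx; exact: hz.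
exact: swap_out.
Qed.

Lemma swap_shift n z : swap n (Defs.shift z) = Defs.shift (swap n z).
Proof.
apply/funext => t; rewrite {2}/Defs.shift.
have [[[b p] /= [zo pt]]|h] := pselect (exists u : bool * int,
    occ z n u.1 u.2 /\ u.2 <= t + 1 < u.2 + (wlen n)%:Z).
  rewrite (swap_in zo pt) (@swap_in _ _ b (p - 1)); last by lia.
    by congr (alpha (word n _ _)); lia.
  by apply/occ_shift; rewrite subrK.
have hz b p : occ z n b p -> ~~ (p <= t + 1 < p + (wlen n)%:Z).
  by move=> o; apply/negP => pt; apply: h; exists (b, p).
rewrite [RHS]swap_out// swap_out// => b p /occ_shift/hz; lia.
Qed.

Lemma swap_local n N z z' : near_agree (N + wlen n) z z' ->
  near_agree N (swap n z) (swap n z').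
Proof.
move=> zz' t tN.
have tr b p : p <= t < p + (wlen n)%:Z -> (occ z n b p <-> occ z' n b p).
  by move=> pt; split => o k kL; rewrite -o ?zz'//; lia.
have [[[b p] /= [zo pt]]|h] := pselect (exists u : bool * int,
    occ z n u.1 u.2 /\ u.2 <= t < u.2 + (wlen n)%:Z).
  by rewrite (swap_in zo pt) (@swap_in _ _ b p)//; apply/tr.
rewrite !swap_out ?zz'//; first by lia.
- by move=> b p o; apply/negP => pt; apply: h; exists (b, p).
- move=> b p o; apply/negP => pt; apply: h; exists (b, p); split=> //.
  exact/tr.
Qed.

Lemma swap_continuous n : continuous (swap n).
Proof.
move=> z U /(nbhs_near_agreeP R)[N NU].
apply: filterS (nbhs_near_agree R (N + wlen n) z) => z' zz'.
exact/NU/swap_local.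
Qed.

Lemma swap_avoid n x y : (forall k, k <> n -> x k = y k) -> x n = ~~ y n ->
  set_fun (avoid alpha x) (avoid alpha y) (swap n).
Proof.
move=> xy xn z zx m p /occ_swapP.
case: eqVneq => [->|/eqP/xy <-]; last exact: zx.
by rewrite -xn; exact: zx.
Qed.

Lemma conjugate_avoid n x y : (forall k, k <> n -> x k = y k) -> x n = ~~ y n ->
  conjugate (avoid alpha x) (@Defs.shift A) (avoid alpha y) (@Defs.shift A).
Proof.
move=> xy xn; exists (swap n); last by move=> z _; exact: swap_shift.
split.
- by apply: continuous_subspaceT; exact: swap_continuous.
- exact: swap_avoid.
- exists (swap n); split.
  + by apply: continuous_subspaceT; exact: swap_continuous.
  + by apply: swap_avoid => [k /xy ->//|]; rewrite xn negbK.
  + by move=> z _; exact: swapK.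
  + by move=> z _; exact: swapK.
Qed.

End Swap.

(** * Continuity of the family of subshifts *)

Section Continuity.
Variables (R : realType) (A : finType) (alpha : bool -> A).
Hypothesis alpha_inj : injective alpha.
Implicit Types (z : full_shift A) (x y : nat -> bool).

(** A point of [avoid x] truncated by [pad] can only contain short words, so
that it belongs to [avoid y] as soon as [y] shares a long prefix with [x]. *)
Lemma prefix_open_hit (U : set (full_shift A)) : open U ->
  prefix_open [set x | (avoid alpha x `&` U) !=set0].
Proof.
move=> oU x [z [zx Uz]].
have [N NU] := nbhs_near_agreeP R (open_nbhs_nbhs (conj oU Uz)).
exists N.+1 => y xy; exists (pad alpha (- N%:Z) (N%:Z + 1) z); split.
  move=> n p /(occ_pad alpha_inj)[l r zo]; apply: (zx n p).
  by rewrite xy//; move: l r; rewrite /wlen; lia.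
apply: NU => t tN; rewrite /pad.
by do ![case: ifP] => //; lia.
Qed.

(** By compactness, finitely many of the forbidden words suffice to exclude all
points outside [U]. *)
Lemma prefix_open_contained (U : set (full_shift A)) : open U ->
  prefix_open [set x | avoid alpha x `<=` U].
Proof.
move=> oU x xU.
have cK : compact (~` U).
  by apply: compact_full_shift; rewrite closedC.
have /compact_near_coveringP/(_ nat \oo) := cK.
move=> /(_ (fun n z => forall y, agree n x y -> ~ avoid alpha y z) _) [].
  move=> z nUz; have /existsNP[n /existsNP[p /contrapT zo]] : ~ avoid alpha x z.
    by move/xU.
  exists (near_agree (`|p|%N + wlen n) z, [set m | n < m]%N) => /=.
    by split; [exact: (nbhs_near_agree R)|exact: nbhs_infty_gt].
  move=> [z' m] /= [zz' nm] y xy /(_ n p); apply.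
  by rewrite -xy// => k kL; rewrite zz' ?zo//; lia.
move=> n _ /(_ n (leqnn n)) nU; exists n => y xy z zy.
by apply: contrapT => /nU /(_ y xy).
Qed.

(** [x |-> avoid x] is continuous for the Vietoris topology. *)
Lemma prefix_open_avoid_system (V : set (spec_systems R A)) : open V ->
  prefix_open (avoid_system R alpha_inj @^-1` V).
Proof.
move=> [W [D' D'D <-] <-] x /= [B D'B Bx].
have [E ED EB] := D'D _ D'B.
pose F : set_system (nat -> bool) := filter_from setT (fun n => agree n x).
have FF : Filter F.
  apply: filter_from_filter; first by exists 0%N.
  move=> i j _ _; exists (maxn i j) => // y xy.
  by split; apply: agreeW xy; rewrite ?leq_maxl ?leq_maxr.
case: (@filter_bigI _ _ E
    (fun C => [set y | C (avoid_space R alpha_inj y)]) F FF) => [C CE|n _ nB].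
  have /set_mem[U oU UC] := ED C CE.
  have Cx : C (avoid_space R alpha_inj x) by move: Bx; rewrite -EB; exact.
  case: UC => UC; move: Cx; rewrite UC.
    by move=> /(prefix_open_contained oU)[n nC]; exists n.
  by move=> /(prefix_open_hit oU)[n nC]; exists n.
exists n => y xy; exists B => //; rewrite -EB => C CE.
exact: nB y xy C CE.
Qed.

Lemma baire_property_avoid_system (B : set (spec_systems R A)) : borel_sets B ->
  baire_property (avoid_system R alpha_inj @^-1` B).
Proof.
move: B; apply: smallest_sub; last first.
  by move=> B /prefix_open_avoid_system; exact: baire_property_open.
split.
- by apply: baire_property_open => x [].
- by move=> B BB; rewrite setTD preimage_setC; exact: baire_propertyC.
- by move=> B BB; rewrite preimage_bigcup; exact: baire_property_bigcup.
Qed.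

End Continuity.

(** * Block codes *)

Section BlockCodes.
Variables (R : realType) (A : finType).
Implicit Types (X Y : set (full_shift A)) (z : full_shift A).

(** The coordinates of [z] from [-N] to [N]. *)
Definition window N z : {ffun 'I_(N.*2.+1) -> A} :=
  [ffun i : 'I_(N.*2.+1) => z (i%:Z - N%:Z)].

(** The [t]-th power of the shift, for an integer [t]. *)
Definition translate (t : int) z : full_shift A := fun s => z (s + t).

(** The sliding block code of radius [N] with local rule [f]. *)
Definition block_map N (f : {ffun {ffun 'I_(N.*2.+1) -> A} -> A}) z :
  full_shift A := fun t => f (window N (translate t z)).

Lemma window_near_agree N z z' : window N z = window N z' -> near_agree N z z'.
Proof.
move=> zz' t tN; have h : (`|(t + N%:Z)%R| < N.*2.+1)%N by lia.
have := congr1 (fun f : {ffun _} => f (Ordinal h)) zz'; rewrite !ffunE /=.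
by rewrite (_ : (`|(t + N%:Z)%R|%N)%:Z - N%:Z = t); last by lia.
Qed.

(** Negative powers of the shift preserve [X] because the shift maps [X] onto
itself and is invertible. *)
Lemma translate_morph X (rho : full_shift A -> full_shift A) :
  @Defs.shift A @` X = X ->
  {in X, forall z, rho (Defs.shift z) = Defs.shift (rho z)} ->
  forall t z, X z ->
    X (translate t z) /\ rho (translate t z) = translate t (rho z).
Proof.
move=> sX rs.
have pos (k : nat) z : X z ->
    X (translate k z) /\ rho (translate k z) = translate k (rho z).
  elim: k z => [|k IH] z Xz.
    have E (u : full_shift A) : translate 0 u = u.
      by apply/funext => s; rewrite /translate addr0.
    by rewrite !E.
  have E (u : full_shift A) : translate k.+1 u = translate k (Defs.shift u).
    by apply/funext => s; rewrite /translate /Defs.shift; congr u; lia.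
  by rewrite !E -rs ?inE//; apply: IH; rewrite -sX; exists z.
have surj (k : nat) z : X z -> X (translate (- k%:Z) z).
  elim: k z => [|k IH] z Xz.
    rewrite (_ : translate _ z = z)//.
    by apply/funext => s; rewrite /translate oppr0 addr0.
  move: Xz; rewrite -{1}sX => -[u /IH Xu <-].
  rewrite (_ : translate _ _ = translate (- k%:Z) u)//.
  by apply/funext => s; rewrite /translate /Defs.shift; congr u; lia.
move=> t z Xz; have [t0|t0] := leP 0 t.
  by case: t t0 => // k _; exact: pos.
have -> : t = - `|t|%N%:Z by lia.
have Xu := surj `|t|%N z Xz; split => //.
have {2}-> : z = translate `|t|%N (translate (- `|t|%N%:Z) z).
  by apply/funext => s; rewrite /translate; congr z; lia.
rewrite (pos _ _ Xu).2.
by apply/funext => s; rewrite /translate; congr (rho _ _); lia.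
Qed.

(** The Curtis-Hedlund-Lyndon theorem; [a0] is the value of the local rule on
the windows that do not occur in [X]. *)
Lemma conjugate_block_map X Y (a0 : A) : closed X -> @Defs.shift A @` X = X ->
  conjugate X (@Defs.shift A) Y (@Defs.shift A) ->
  exists N f, Y = block_map (N := N) f @` X.
Proof.
move=> cX sX [rho [rhoc XY [g [_ YX _ gK]]] rs].
(* By compactness, the coordinate 0 of [rho z] depends on a bounded window. *)
have [N NP] : exists N, forall z z', X z -> X z' -> near_agree N z z' ->
    rho z' 0 = rho z 0.
  have /compact_near_coveringP/(_ nat \oo) := compact_full_shift cX.
  move=> /(_ (fun N z => forall z', X z -> X z' -> near_agree N z z' ->
    rho z' 0 = rho z 0) _) [].
    move=> z Xz.
    have /nbhs_near_agreeP : nbhs z [set z' | X z' -> rho z' 0 = rho z 0].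
      have /subspace_continuousP/(_ z Xz) rz := rhoc.
      have : nbhs z [set z' | X z' -> near_agree 0 (rho z) (rho z')].
        exact: (rz _ (nbhs_near_agree R 0%N (rho z))).
      by apply: filterS => z' zz' /zz'; apply.
    move=> /(_ R)[M MP]; exists (near_agree M z, [set N | M <= N]%N) => /=.
      by split; [exact: (nbhs_near_agree R)|exact: nbhs_infty_ge].
    move=> [u N] /= [zu MN] v Xu Xv uv.
    rewrite (MP u)// MP// => t tM; rewrite uv ?zu//; exact: leq_trans MN.
  by move=> N _ /(_ N (leqnn N)) NP; exists N => z z' Xz; exact: NP.
pose f : {ffun {ffun 'I_(N.*2.+1) -> A} -> A} := [ffun w =>
  xget a0 [set a | exists2 z, X z & window N z = w /\ rho z 0 = a]].
exists N, f.
have fE z : X z -> block_map f z = rho z.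
  move=> Xz; apply/funext => t; rewrite /block_map ffunE.
  have [Xt rt] := translate_morph sX rs t Xz.
  apply: xget_unique.
    by exists (translate t z) => //; split => //; rewrite rt /translate add0r.
  move=> _ [u Xu [/esym/window_near_agree wu <-]].
  by rewrite (NP _ _ Xt Xu wu) rt /translate add0r.
apply/seteqP; split => [y Yy|_ [z Xz <-]].
  by exists (g y); [exact: YX|rewrite fE ?gK ?inE//; exact: YX].
by rewrite fE//; exact: XY.
Qed.

End BlockCodes.

(** * Non-smoothness *)

(** The interiors of the balls with radius [1 / (k + 1)] around the points of a
countable dense set; the first index numbers the centre, the second is [k]. *)
Lemma separating_open_family (R : realType) (M : completePseudoMetricType R) :
  hausdorff_space M -> (exists2 D : set M, countable D & dense D) ->
  exists B : nat * nat -> set M, (forall i, open (B i)) /\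
    forall p q, (forall i, B i p -> B i q) -> p = q.
Proof.
move=> hM [D /countable_injP[f finj] dD].
exists (fun i => \bigcup_(d in D `&` [set d | f d = i.1])
  (ball d (i.2.+1%:R^-1 : R))°).
split=> [i|p q pq]; first by apply: bigcup_open => d _; exact: open_interior.
apply: contrapT => /eqP npq.
have := hM; rewrite open_hausdorff => /(_ _ _ npq).
move=> [[U V]/= [/set_mem Up /set_mem Vq] [oU oV UV]].
have /nbhs_ballP[e /= e0 eU] := open_nbhs_nbhs (conj oU Up).
have [k ke] : exists k : nat, k.+1%:R^-1 < e / 2 :> R.
  have [k _ /(_ k (leqnn k))] :=
    near_infty_natSinv_lt (PosNum (divr_gt0 e0 (ltr0Sn R 1))).
  by exists k.
set r : R := k.+1%:R^-1; have r0 : 0 < r by rewrite invr_gt0.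
have r20 : 0 < r / 2 by rewrite divr_gt0.
have [d [+ Dd]] : (ball p (r / 2))° `&` D !=set0.
  apply: dD; last exact: open_interior.
  by exists p; exact: nbhsx_ballx.
move=> /interior_subset pd.
have [d' [Dd' fd] /interior_subset d'q] :
    (\bigcup_(d' in D `&` [set d' | f d' = f d]) (ball d' r)°) q.
  apply: (pq (f d, k)); exists d; first by split.
  rewrite /interior /=; have := nbhsx_ballx p _ r20; apply: filterS => u pu.
  by rewrite -/r (splitr r); apply: ball_triangle pu; exact: ball_sym.
have dd : d' = d by apply: finj; rewrite ?inE.
subst d'.
have : U q.
  apply: eU; apply: (@le_ball _ _ p (r + r)).
    by rewrite (splitr e) lerD// ltW.
  apply: ball_triangle d'q; apply: le_ball pd.
  by rewrite ler_pdivrMr// ler_peMr ?ler1n// ltW.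
by move=> Uq; have /eqP := UV; rewrite -subset0 => /(_ q); apply.
Qed.

Section NonSmooth.
Variables (R : realType) (A : finType) (alpha : bool -> A).
Hypothesis alpha_inj : injective alpha.

(** Each of the countably many block codes maps [avoid x0] onto [avoid x] for at
most one [x]. *)
Lemma meager_conjugacy_class x0 :
  meager [set x |
    conjugacy (avoid_system R alpha_inj x0) (avoid_system R alpha_inj x)].
Proof.
pose code := {N : nat & {ffun {ffun 'I_(N.*2.+1) -> A} -> A}}.
apply: (@sub_meager _ (\bigcup_(c : code)
  [set x | avoid alpha x = block_map (tagged c) @` avoid alpha x0])).
  move=> x /(conjugate_block_map R (alpha true) (@closed_avoid R A alpha x0)).
  case=> [|N [f Ef]]; first exact: shift_avoid.
  by exists (existT _ N f).
apply: meager_bigcup => c; apply: nowhere_dense_meager.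
have [[x /= Ex]|nx] := pselect (exists x,
    avoid alpha x = block_map (tagged c) @` avoid alpha x0).
  rewrite (_ : [set y | _] = [set x]); first exact: nowhere_dense1.
  apply/seteqP; split=> [y /= Ey|_ ->//]; apply: (avoid_inj alpha_inj).
  by rewrite Ey Ex.
rewrite (_ : [set y | _] = set0); first exact: nowhere_dense0.
by apply/seteqP; split=> // y Ey; apply: nx; exists y.
Qed.

Lemma conjugacy_not_smooth : ~ smooth R (@conjugacy R A).
Proof.
move=> [d [Y [f [[M [hM sM [g [g' gK g'K] mY]]] fB fE]]]].
have [B [oB Bsep]] := separating_open_family hM sM.
pose h x := g (f (avoid_system R alpha_inj x)).
have bpS i : baire_property [set x | B i (h x)].
  apply: (@baire_property_avoid_system R A alpha alpha_inj
    (f @^-1` (g @^-1` B i))).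
  apply: fB; rewrite mY; exists (B i) => //; exact: sub_sigma_algebra.
have h_inv n x y : (forall k, k <> n -> x k = y k) -> h x = h y.
  move=> xy; have [xyn|xyn] := eqVneq (x n) (y n).
    congr h; apply/funext => k; have [->//|/eqP] := eqVneq k n; exact: xy.
  rewrite /h; congr g; apply/fE; apply: (conjugate_avoid R alpha_inj xy).
  by move: xyn; case: (x n); case: (y n).
have inv i n x y : (forall k, k <> n -> x k = y k) -> B i (h x) -> B i (h y).
  by move=> /h_inv ->.
have dich i := zero_one_law (bpS i) (inv i).
(* [Z i] is the meager one of the preimage of [B i] and its complement. *)
pose Z i := [set x |
  if pselect (meager [set x | B i (h x)]) then B i (h x) else ~ B i (h x)].
have mZ : meager (\bigcup_i Z i).
  apply: meager_bigcup => i; rewrite /Z; case: pselect => [//|nm] /=.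
  by have [] := dich i.
have [x0 Zx0] : exists x0, ~ (\bigcup_i Z i) x0.
  apply: contrapT => /forallNP nZ; apply: baire_category.
  by apply: sub_meager mZ => x _; exact: contrapT (nZ x).
apply: baire_category.
apply: sub_meager (meagerU mZ (meager_conjugacy_class x0)) => x _.
have [Zx|Zx] := pselect ((\bigcup_i Z i) x); [by left|right].
apply/fE/(can_inj gK)/Bsep => i.
have := contra_not (fun Zi => ex_intro2 _ _ i I Zi : (\bigcup_i Z i) x) Zx.
have := contra_not (fun Zi => ex_intro2 _ _ i I Zi : (\bigcup_i Z i) x0) Zx0.
rewrite /Z /=; case: pselect => /= _ nx0 nx; first by move=> /nx0.
by move=> _; exact: contrapT nx.
Qed.

End NonSmooth.

Theorem theorem1p1 (R : realType) (A : finType) (A_ge2 : (2 <= #|A|)%N) :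
  ~ smooth R (@conjugacy R A).
Proof.
have /card_gt1P[a [b [_ _ ab]]] := A_ge2.
apply: (@conjugacy_not_smooth R A (fun c : bool => if c then a else b)).
by case; case=> //= e; rewrite e eqxx in ab.
Qed.
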